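(* Let $n\ge 3$ and let $\Gamma$ be a finite index subgroup of $\mathrm{SL}_n(\mathbb{Z})$. Then every boomerang subgroup of $\Gamma$ is either contained in $\{\pm e\}$, where $e$ is the identity matrix, or has finite index in $\Gamma$.
   Context: A subgroup $\Delta$ of a countable discrete group $\Gamma$ is a boomerang subgroup of $\Gamma$ if for every $\gamma\in\Gamma$ and every finite subset $F\subset\Gamma$ there are infinitely many integers $n\ge 1$ with $\Delta\cap F=\gamma^n\Delta\gamma^{-n}\cap F$. *)

(* Defs.v *)
From HB Require Import structures.
From mathcomp Require Import all_boot all_order all_algebra.
From mathcomp Require Import all_classical.

Set Implicit Arguments.
Unset Strict Implicit.
Unset Printing Implicit Defensive.

Import GRing.Theory.

Section SpecialLinear.
Local Open Scope ring_scope.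
Variables (n : nat) (R : comUnitRingType).

Record SL := MkSL { slmx :> 'M[R]_n; slmx_det : \det slmx == 1 }.

HB.instance Definition _ := [isSub for slmx].
HB.instance Definition _ := [Choice of SL by <:].

Fact SL_one_subproof : \det (1%:M : 'M[R]_n) == 1.
Proof. by rewrite det1. Qed.

Fact SL_mul_subproof (A B : SL) : \det (slmx A *m slmx B) == 1.
Proof. by rewrite det_mulmx (eqP (slmx_det A)) (eqP (slmx_det B)) mulr1. Qed.

Fact SL_unitmx (A : SL) : slmx A \in unitmx.
Proof. by rewrite unitmxE (eqP (slmx_det A)) unitr1. Qed.

Fact SL_inv_subproof (A : SL) : \det (invmx (slmx A)) == 1.
Proof. by rewrite det_inv (eqP (slmx_det A)) invr1. Qed.

Definition SL_one : SL := MkSL SL_one_subproof.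
Definition SL_mul (A B : SL) : SL := MkSL (SL_mul_subproof A B).
Definition SL_inv (A : SL) : SL := MkSL (SL_inv_subproof A).

Fact SL_mulA : associative SL_mul.
Proof. by move=> A B C; apply: val_inj; rewrite /= mulmxA. Qed.

Fact SL_mul1 : left_id SL_one SL_mul.
Proof. by move=> A; apply: val_inj; rewrite /= mul1mx. Qed.

Fact SL_mulr1 : right_id SL_one SL_mul.
Proof. by move=> A; apply: val_inj; rewrite /= mulmx1. Qed.

Fact SL_mulV : left_inverse SL_one SL_inv SL_mul.
Proof. by move=> A; apply: val_inj; rewrite /= mulVmx ?SL_unitmx. Qed.

Fact SL_mulrV : right_inverse SL_one SL_inv SL_mul.
Proof. by move=> A; apply: val_inj; rewrite /= mulmxV ?SL_unitmx. Qed.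

HB.instance Definition _ :=
  isGroup.Build SL SL_mulA SL_mul1 SL_mulr1 SL_mulV SL_mulrV.

End SpecialLinear.

Section Subgroups.
Local Open Scope group_scope.
Local Open Scope classical_set_scope.
Variable G : groupType.
Implicit Types Gamma Delta H : set G.

Definition is_subgroup H : Prop := group_closed (mem H).

Definition subgroup_of Gamma Delta : Prop :=
  is_subgroup Delta /\ Delta `<=` Gamma.

Definition left_coset (x : G) H : set G := [set x * h | h in H].

Definition finite_index Gamma Delta : Prop :=
  finite_set [set left_coset x Delta | x in Gamma].

(* x H x^-1; the library's conjugate x ^ y is y^-1 x y, the other convention. *)
Definition conj_set (x : G) H : set G := [set x * h * x^-1 | h in H].

Definition boomerang Gamma Delta : Prop :=
  subgroup_of Gamma Delta /\
  forall (g : G) (F : set G), Gamma g -> finite_set F -> F `<=` Gamma ->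
    infinite_set [set k : nat | (1 <= k)%N /\
                    Delta `&` F = conj_set (g ^+ k) Delta `&` F].

End Subgroups.

(* Main.v *)
Require Import Defs.
From mathcomp Require Import all_boot all_order all_algebra.
From mathcomp Require Import all_classical.
From mathcomp Require Import zify.

Set Implicit Arguments.
Unset Strict Implicit.
Unset Printing Implicit Defensive.

Import GRing.Theory Num.Theory.

(** The argument shows that a subgroup Delta of SL_n(Z), n >= 3, which contains
    a matrix x other than 1 and -1 has finite index as soon as it is closed under
    the following weak form of conjugation: for every x in Delta and every t in
    SL_n(Z), some t^k x t^-k with k >= 1 lies in Delta.  A boomerang subgroup of a
    finite index subgroup has this property: some power t^r lies in Gamma, and
    the boomerang condition for t^-r and the finite set {x} gives the exponent
    ([boomerang_power_recurrent]).

    Everything is done with transvections 1 + v f, where v is a column, f a row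
    and f v = 0; the matrix is written [tv v f].

    Producing a transvection.  Since x is not central, it fails to commute with
    some elementary matrix 1 + E_ij.  A commutator g = [(1 + E_ij)^k, x] in Delta
    fixes every vector killed by two given rows, hence a nonzero vector u because
    n >= 3.  The commutator of g with a power of a transvection in direction u is
    again a transvection in direction u; if all these commutators are trivial,
    then g - 1 has image in the line of u and a power of g is a transvection
    ([transvection_of_fixed_vector]).

    Spreading it.  Conjugating 1 + v f by powers of a transvection with direction
    w in ker f, and dividing by 1 + v f, leaves a power of 1 + w f.  So the
    direction can be moved inside ker f, and dually the row can be moved inside
    the annihilator of v.  Going through a vector killed by both rows, one reaches
    all elementary transvections: Delta contains all 1 + m E_ij for a single
    m >= 1 ([common_elem_power]).

    Normality.  If H contains all 1 + m E_ij, then H contains all conjugates in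
    SL_n(Z) of the matrices 1 + m^2 E_ij.  Such a conjugate is 1 + m^2 v f with v
    unimodular; then f is a combination of the Koszul rows v_l e_k - v_k e_l, and
    a row with a zero coordinate p gives a matrix that is an explicit commutator of
    transvections involving e_p ([sub_tv_unimodular]).  Hence the normal core N of
    Delta in SL_n(Z) contains all 1 + m^2 E_ij ([normal_core_elem]).

    Finiteness of SL_n(Z)/N.  Modulo a normal subgroup N containing all
    1 + m E_ij, the conjugate of 1 + E_ij by g depends only on the residue of g
    modulo m ([eqmod_congruent_conj]).  So the elements 1 + E_ij have finitely many
    conjugates in the quotient, and they are torsion there.  By Dietzmann's lemma a
    finite conjugation-invariant set of torsion elements generates a finite group
    ([dietzmann]), and SL_n(Z) is generated by the 1 + E_ij by Euclid's algorithm
    ([elementary_generation]).  Thus N, and a fortiori Delta, has finite index. *)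

(** * Subgroups, congruence modulo a normal subgroup, finite index *)

Section SubgroupTheory.
Local Open Scope group_scope.
Local Open Scope classical_set_scope.
Variable G : groupType.
Implicit Types (H N Gamma Delta : set G) (x y g : G).

Lemma subgroup1 H : is_subgroup H -> H 1.
Proof. by case=> /set_mem. Qed.

Lemma subgroupV H x : is_subgroup H -> H x -> H x^-1.
Proof.
by move=> /group_closedV hV Hx; apply/set_mem/(hV x); apply/mem_set.
Qed.

Lemma subgroupM H x y : is_subgroup H -> H x -> H y -> H (x * y).
Proof.
by move=> /group_closedM hM Hx Hy; apply/set_mem/hM; apply/mem_set.
Qed.

Lemma subgroupX H x k : is_subgroup H -> H x -> H (x ^+ k).
Proof.
move=> hH Hx; elim: k => [|k IHk]; first exact: subgroup1.
by rewrite expgS; apply: subgroupM.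
Qed.

Lemma is_subgroup_intro H :
    H 1 -> (forall x, H x -> H x^-1) -> (forall x y, H x -> H y -> H (x * y)) ->
  is_subgroup H.
Proof.
move=> H1 HV HM; split; first exact/mem_set.
by move=> x y /set_mem Hx /set_mem Hy; apply/mem_set/HM => //; apply: HV.
Qed.

Lemma subgroup_mull H x y : is_subgroup H -> H x -> H (x * y) -> H y.
Proof.
move=> hH Hx Hxy; rewrite -(mulKg x y).
by apply: subgroupM => //; apply: subgroupV.
Qed.

Definition normal_set N := forall g x, N x -> N (g * x * g^-1).

Definition normal_core H : set G := [set x | forall g, H (g * x * g^-1)].

Lemma conjg_mul g x y : g * (x * y) * g^-1 = (g * x * g^-1) * (g * y * g^-1).
Proof. by rewrite !mulgA mulgVK. Qed.

Lemma conjg_inv g x : g * x^-1 * g^-1 = (g * x * g^-1)^-1.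
Proof. by rewrite !invgM invgK !mulgA. Qed.

Lemma conjg_exp g x k : g * x ^+ k * g^-1 = (g * x * g^-1) ^+ k.
Proof.
elim: k => [|k IHk]; first by rewrite !expg0 mulg1 mulgV.
by rewrite !expgS conjg_mul IHk.
Qed.

Lemma normal_core_subgroup H : is_subgroup H -> is_subgroup (normal_core H).
Proof.
move=> hH; apply: is_subgroup_intro => [g|x Hx g|x y Hx Hy g].
- by rewrite mulg1 mulgV; apply: subgroup1.
- by rewrite conjg_inv; apply: subgroupV (Hx g).
- by rewrite conjg_mul; apply: subgroupM.
Qed.

Lemma normal_core_normal H : normal_set (normal_core H).
Proof. by move=> g x Hx h; have := Hx (h * g); rewrite invgM !mulgA. Qed.

Lemma normal_core_sub H : normal_core H `<=` H.
Proof. by move=> x /(_ 1); rewrite mul1g invg1 mulg1. Qed.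

(** Quotient groups are replaced by this relation; for normal [N] it is the
    equality of images in the quotient. *)
Definition eqmod N x y := N (x^-1 * y).

Section Eqmod.
Variables (N : set G) (hN : is_subgroup N) (nN : normal_set N).

Lemma eqmod_refl x : eqmod N x x.
Proof. by rewrite /eqmod mulVg; apply: subgroup1. Qed.

Lemma eqmod_sym x y : eqmod N x y -> eqmod N y x.
Proof. by move=> /(subgroupV hN); rewrite invgM invgK. Qed.

Lemma eqmod_trans y x z : eqmod N x y -> eqmod N y z -> eqmod N x z.
Proof. by move=> h1 h2; have := subgroupM hN h1 h2; rewrite mulgA mulgK. Qed.

Lemma eqmodM x x' y y' :
  eqmod N x x' -> eqmod N y y' -> eqmod N (x * y) (x' * y').
Proof.
move=> hx hy; rewrite /eqmod.
have -> : (x * y)^-1 * (x' * y') =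
          (y^-1 * (x^-1 * x') * y^-1^-1) * (y^-1 * y').
  by rewrite invgK invgM !mulgA mulgK.
by apply: subgroupM => //; apply: nN.
Qed.

Lemma eqmodV x x' : eqmod N x x' -> eqmod N x^-1 x'^-1.
Proof.
by move=> /eqmod_sym /(nN x'); rewrite /eqmod mulVKg invgK.
Qed.

Lemma eqmodJ g x x' : eqmod N x x' -> eqmod N (g * x * g^-1) (g * x' * g^-1).
Proof. by move=> hx; do 2?apply: eqmodM => //; apply: eqmod_refl. Qed.

Lemma eqmod_mulr x y : N y -> eqmod N (x * y) x.
Proof. by move=> Ny; apply: eqmod_sym; rewrite /eqmod mulKg. Qed.

Lemma eqmod1 x : N x -> eqmod N x 1.
Proof. by move=> /(subgroupV hN); rewrite /eqmod mulg1. Qed.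

Lemma eqmod_left_coset x y : eqmod N x y -> left_coset x N = left_coset y N.
Proof.
have sub u v : eqmod N u v -> left_coset u N `<=` left_coset v N.
  move=> /eqmod_sym huv _ [h Nh <-]; exists (v^-1 * u * h).
    exact: subgroupM.
  by rewrite !mulgA mulgV mul1g.
by move=> hxy; apply/seteqP; split; apply: sub => //; apply: eqmod_sym.
Qed.

End Eqmod.

(** Pigeonhole: two of the cosets of the powers of [x] coincide. *)
Lemma finite_index_power Gamma x :
    is_subgroup Gamma -> finite_index setT Gamma ->
  exists2 k, (0 < k)%N & Gamma (x ^+ k).
Proof.
move=> hG fG; apply: contrapT => nopow; apply: infinite_nat.
pose B := [set left_coset y Gamma | y in setT].
rewrite (_ : setT = (fun k => left_coset (x ^+ k) Gamma) @^-1` B); last first.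
  by apply/seteqP; split=> k //= _; exists (x ^+ k).
apply: finite_preimage fG => i j _ _.
have lt_neq a b : (a < b)%N ->
    left_coset (x ^+ a) Gamma = left_coset (x ^+ b) Gamma -> False.
  move=> ab eqab; apply: nopow; exists (b - a)%N; first by rewrite subn_gt0.
  have : left_coset (x ^+ a) Gamma (x ^+ b).
    by rewrite eqab; exists 1; rewrite ?mulg1 //; apply: subgroup1.
  case=> h Gh; have -> : x ^+ b = x ^+ a * x ^+ (b - a).
      by rewrite -expgnDr subnKC // ltnW.
    by move=> /mulgI <-.
by case: (ltngtP i j) => // [/lt_neq h /h|/lt_neq h /esym /h].
Qed.

Lemma finite_index_super N Gamma Delta :
    is_subgroup N -> is_subgroup Delta -> N `<=` Delta ->
  finite_index setT N -> finite_index Gamma Delta.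
Proof.
move=> hN hD sND fN.
pose f (C : set G) : set G := [set c * h | c in C & h in Delta].
apply: (@sub_finite_set _ _ (f @` [set left_coset x N | x in setT])); last first.
  exact: finite_image.
move=> _ [x _ <-]; exists (left_coset x N); first by exists x.
apply/seteqP; split=> [_ [_ [a Na <-] [h Dh <-]]|_ [h Dh <-]].
  by exists (a * h); rewrite ?mulgA //; apply: subgroupM => //; apply: sND.
exists x; last by exists h.
by exists 1; rewrite ?mulg1 //; apply: subgroup1.
Qed.

End SubgroupTheory.

(** * Dietzmann's lemma *)

Section Dietzmann.
(* The family X is closed under conjugation, through the action act on its index
   type; lab sorts it into finitely many classes modulo N. *)
Local Open Scope group_scope.
Local Open Scope classical_set_scope.
Variables (G : groupType) (N : set G) (I : Type) (K : finType).
Variables (X : I -> G) (act : G -> I -> I) (lab : I -> K) (d : nat).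
Hypotheses (hN : is_subgroup N) (nN : normal_set N).
Hypothesis actE : forall g i, X (act g i) = g * X i * g^-1.
Hypothesis labP : forall i j, lab i = lab j -> eqmod N (X i) (X j).
Hypotheses (d_gt0 : (0 < d)%N) (XdN : forall i, N (X i ^+ d)).

Let word (s : seq I) : G := foldr (fun i p => X i * p) 1 s.

Let word_cat s t : word (s ++ t) = word s * word t.
Proof. by elim: s => [|i s IHs] /=; rewrite ?mul1g // IHs mulgA. Qed.

Let word_act g s : word (map (act g) s) = g * word s * g^-1.
Proof.
by elim: s => [|i s IHs] /=; rewrite ?mulg1 ?mulgV // IHs actE conjg_mul.
Qed.

Let occ k (s : seq I) := count (fun i => lab i == k) s.

(** Moving the first letter of a given class to the front conjugates only the
    letters before it, none of which has that class; so no occurrence of the class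
    is lost, and the process can be repeated. *)
Let collect i0 k s : (k <= occ (lab i0) s)%N ->
  exists2 s', size s = (size s' + k)%N & eqmod N (word s) (X i0 ^+ k * word s').
Proof.
elim: k s => [|k IHk] s.
  by exists s; rewrite ?addn0 // expg0 mul1g; apply: eqmod_refl.
move=> k_lt; have hs : has (fun i => lab i == lab i0) s.
  by rewrite has_count (leq_trans _ k_lt).
case: (split_find hs) k_lt => i s1 s2 /eqP labi ns1 k_lt.
have {}k_lt : (k <= occ (lab i0) (map (act (X i)^-1) s1 ++ s2))%N.
  move: k_lt; rewrite -cats1 /occ !count_cat /= labi eqxx addn0.
  move: ns1; rewrite has_count -leqNgt leqn0 => /eqP ->.
  by rewrite add0n add1n ltnS => /leq_trans; apply; apply: leq_addl.
have [s' sz_s' eq_s'] := IHk _ k_lt.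
exists s'.
  by move: sz_s'; rewrite size_cat size_map size_cat size_rcons addSn addnS => ->.
have -> : word (rcons s1 i ++ s2) = X i * word (map (act (X i)^-1) s1 ++ s2).
  by rewrite -cats1 !word_cat word_act /= invgK mulg1 -!mulgA mulVKg.
by rewrite expgS -mulgA; apply: eqmodM => //; apply: labP.
Qed.

Let size_occ s : size s = (\sum_k occ k s)%N.
Proof.
elim: s => [|i s IHs] /=; first by rewrite big1.
rewrite big_split /= -IHs (bigD1 (lab i)) //= eqxx big1 ?addn0 ?add1n //.
by move=> k /negPf; rewrite eq_sym => ->.
Qed.

(** In a word longer than [#|K| * d] some class occurs [d] times; once collected in
    front, these letters form a [d]-th power, which is trivial modulo [N]. *)
Let shorten_word s :
  exists2 s', (size s' <= #|K| * d)%N & eqmod N (word s) (word s').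
Proof.
have [m] := ubnP (size s); elim: m s => // m IHm s; rewrite ltnS => le_sm.
case: (leqP (size s) (#|K| * d)) => [small|big].
  by exists s => //; apply: eqmod_refl.
have [i0 i0P] : exists i0, (d <= occ (lab i0) s)%N.
  apply: contrapT => few; move: big; rewrite ltnNge => /negP; apply.
  rewrite size_occ -sum_nat_const; apply: leq_sum => k _.
  case: (boolP (has (fun i => lab i == k) s)) => [hs|]; last first.
    by rewrite has_count -leqNgt leqn0 /occ => /eqP ->.
  have [i <-] : exists i, lab i = k.
    by case: (split_find hs) => i s1 s2 /eqP; exists i.
  by rewrite leqNgt; apply/negP => /ltnW hd; apply: few; exists i.
have [s' sz_s' eq_s'] := collect i0P.
have lt_s' : (size s' < m)%N.
  by apply: leq_trans le_sm; rewrite sz_s' -addn1 leq_add2l.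
have [t sz_t eq_t] := IHm _ lt_s'.
exists t => //; apply: eqmod_trans eq_t => //; apply: eqmod_trans eq_s' _ => //.
rewrite -[word s' in X in eqmod _ _ X]mul1g; apply: eqmodM => //.
  exact: eqmod1.
exact: eqmod_refl.
Qed.

(** Words of bounded length over finitely many classes represent all elements
    modulo [N].  Inverses of generators are positive powers, because the generators
    are torsion modulo [N]. *)
Theorem dietzmann :
    (forall H, is_subgroup H -> (forall i, H (X i)) -> forall g, H g) ->
  finite_index setT N.
Proof.
move=> gen.
have words g : exists s, eqmod N g (word s).
  pose S : set G := [set g | exists s, eqmod N g (word s)].
  have S1 : S 1 by exists [::]; apply: eqmod_refl.
  have SM x y : S x -> S y -> S (x * y).
    by move=> [s hs] [t ht]; exists (s ++ t); rewrite word_cat; apply: eqmodM.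
  have Seq x y : eqmod N x y -> S y -> S x.
    by move=> hxy [s hs]; exists s; apply: eqmod_trans hs.
  have SX i : S (X i) by exists [:: i]; rewrite /= mulg1; apply: eqmod_refl.
  have SXk i k : S (X i ^+ k).
    by elim: k => [|k IHk]; rewrite ?expg0 // expgS; apply: SM.
  have SVw s : S (word s)^-1.
    elim: s => [|i s IHs] /=; first by rewrite invg1.
    rewrite invgM; apply: SM => //; apply: Seq (SXk i d.-1).
    by rewrite /eqmod invgK -expgS prednK.
  apply: (gen S) => //; apply: is_subgroup_intro => // x [s hs].
  by apply: Seq (SVw s); apply: eqmodV.
pose rep k : G := if pselect (exists i, lab i = k) is left e
                  then X (projT1 (cid e)) else 1.
have repP i : eqmod N (X i) (rep (lab i)).
  rewrite /rep; case: pselect => [e|[]]; last by exists i.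
  by case: cid => j /= labj; apply: labP.
pose F (t : {bseq (#|K| * d) of K}) : set G :=
  left_coset (foldr (fun k p => rep k * p) 1 t) N.
apply: (@sub_finite_set _ _ (F @` setT)); last exact/finite_image/finite_finset.
move=> _ [g _ <-]; have [s gs] := words g.
have [t sz_t st] := shorten_word s.
have sz_lab : (size (map lab t) <= #|K| * d)%N by rewrite size_map.
exists (Bseq sz_lab) => //.
apply: eqmod_left_coset => //; apply: eqmod_sym => //.
apply: eqmod_trans gs _ => //; apply: eqmod_trans st _ => //.
rewrite /=; elim: (t) => [|i u IHu] /=; first exact: eqmod_refl.
by apply: eqmodM.
Qed.

End Dietzmann.

(** * Transvections *)

Section Transvections.
Local Open Scope ring_scope.
Variables (n : nat) (R : comUnitRingType).
Implicit Types (v w : 'cV[R]_n) (f g : 'rV[R]_n) (x : SL n R).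

(** The default value 1 is returned when the matrix has determinant other than 1;
    it has determinant 1 as soon as [f *m v = 0]. *)
Definition tv v f : SL n R := insubd (1%g : SL n R) (1%:M + v *m f).

(** Both sides are the determinant of the block matrix with rows [1 v] and [-f 1]. *)
Lemma det_add1_mul v f : \det (1%:M + v *m f) = \det (1%:M + f *m v).
Proof.
pose B : 'M[R]_(n + 1) := block_mx 1%:M v (- f) 1%:M.
have -> : \det (1%:M + v *m f) = \det B.
  have -> : \det B = \det (block_mx (1%:M + v *m f) v 0 1%:M *m
                           block_mx 1%:M 0 (- f) 1%:M).
    rewrite mulmx_block !mulmx1 !mul0mx !mulmx0 !mul1mx !add0r mulmxN addrK.
    by [].
  by rewrite det_mulmx det_ublock det_lblock !det1 !mulr1.
have -> : B = block_mx 1%:M 0 (- f) 1%:M *m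
              block_mx 1%:M v 0 (1%:M + f *m v).
  rewrite mulmx_block !mulmx1 !mul0mx !mulmx0 !mul1mx !addr0 mulNmx.
  by rewrite addrCA addNr addr0.
by rewrite det_mulmx det_ublock det_lblock !det1 !mul1r.
Qed.

Lemma slmx_tv v f : f *m v = 0 -> slmx (tv v f) = 1%:M + v *m f.
Proof.
move=> fv0; rewrite /tv; apply: (insubdK (1%g : SL n R)).
by rewrite unfold_in det_add1_mul fv0 addr0 det1.
Qed.

Lemma slmxM x y : slmx (x * y)%g = slmx x *m slmx y. Proof. by []. Qed.

Lemma slmx_mulV x : slmx x *m slmx (x^-1)%g = 1%:M.
Proof. by rewrite -slmxM mulgV. Qed.

Lemma slmx_mulVl x : slmx (x^-1)%g *m slmx x = 1%:M.
Proof. by rewrite -slmxM mulVg. Qed.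

Lemma tvZ (a : R) v f : tv (a *: v) f = tv v (a *: f).
Proof. by rewrite /tv -scalemxAl scalemxAr. Qed.

Lemma tv0r v : tv v 0 = 1%g.
Proof. by apply: val_inj; rewrite /= slmx_tv ?mul0mx // mulmx0 addr0. Qed.

Lemma tv0l f : tv 0 f = 1%g.
Proof. by apply: val_inj; rewrite /= slmx_tv ?mulmx0 // mul0mx addr0. Qed.

Lemma tvDr v f g : f *m v = 0 -> g *m v = 0 -> tv v (f + g) = (tv v f * tv v g)%g.
Proof.
move=> fv gv; apply: val_inj; rewrite /= !slmx_tv ?mulmxDl ?fv ?gv ?addr0 //.
rewrite !mulmxDr !mul1mx mulmx1 -!mulmxA [f *m (v *m g)]mulmxA fv mul0mx mulmx0.
by rewrite addr0 addrA addrAC.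
Qed.

Lemma tvDl v w f : f *m v = 0 -> f *m w = 0 -> tv (v + w) f = (tv v f * tv w f)%g.
Proof.
move=> fv fw; apply: val_inj; rewrite /= !slmx_tv ?mulmxDr ?fv ?fw ?addr0 //.
rewrite !mulmxDl !mul1mx mulmx1 -!mulmxA [f *m (w *m f)]mulmxA fw mul0mx mulmx0.
by rewrite addr0 addrA addrAC.
Qed.

Lemma tvN v f : f *m v = 0 -> (tv v (- f) = (tv v f)^-1)%g.
Proof.
move=> fv; apply: (mulgI (tv v f)); rewrite mulgV -tvDr ?mulNmx ?fv ?oppr0 //.
by rewrite subrr tv0r.
Qed.

Lemma tvX v f k : f *m v = 0 -> (tv v f ^+ k)%g = tv v (k%:R *: f).
Proof.
move=> fv; elim: k => [|k IHk]; first by rewrite expg0 scale0r tv0r.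
have kfv : k%:R *: f *m v = 0 by rewrite -scalemxAl fv scaler0.
by rewrite expgS IHk -tvDr // mulrS scalerDl scale1r.
Qed.

Lemma tvJ x v f : f *m v = 0 ->
  (x * tv v f * x^-1)%g = tv (slmx x *m v) (f *m slmx (x^-1)%g).
Proof.
move=> fv; have fv' : f *m slmx (x^-1)%g *m (slmx x *m v) = 0.
  by rewrite -mulmxA (mulmxA (slmx _)) slmx_mulVl mul1mx.
apply: val_inj; rewrite [RHS]slmx_tv // [LHS]slmxM slmxM slmx_tv //.
by rewrite mulmxDr mulmx1 mulmxDl slmx_mulV !mulmxA.
Qed.

Lemma tv_mulcol v f w : f *m v = 0 -> slmx (tv v f) *m w = w + (f *m w) 0 0 *: v.
Proof.
move=> fv; rewrite slmx_tv // mulmxDl mul1mx -mulmxA.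
by rewrite {1}[f *m w]mx11_scalar mul_mx_scalar.
Qed.

Lemma row_mul_tv v f g : f *m v = 0 -> g *m slmx (tv v f) = g + (g *m v) 0 0 *: f.
Proof.
move=> fv; rewrite slmx_tv // mulmxDr mulmx1 mulmxA.
by rewrite {1}[g *m v]mx11_scalar mul_scalar_mx.
Qed.

Lemma tvJtv v f w g : f *m v = 0 -> g *m w = 0 ->
  (tv w g * tv v f * (tv w g)^-1)%g =
  tv (v + (g *m v) 0 0 *: w) (f - (f *m w) 0 0 *: g).
Proof.
move=> fv gw; rewrite tvJ // -tvN // tv_mulcol // row_mul_tv ?mulNmx ?gw ?oppr0 //.
by rewrite scalerN.
Qed.

Lemma mul_erow (i : 'I_n) v : 'e_i *m v = (v i 0)%:M.
Proof. by rewrite -rowE [LHS]mx11_scalar mxE. Qed.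

Lemma mul_ecol (i : 'I_n) f : f *m delta_mx i 0 = (f 0 i)%:M.
Proof. by rewrite -colE [LHS]mx11_scalar mxE. Qed.

Lemma erow_ecol (i j : 'I_n) : i != j -> ('e_j : 'rV[R]_n) *m delta_mx i 0 = 0 :> 'M_1.
Proof. by move=> ij; rewrite mul_delta_mx_0 // eq_sym. Qed.

Lemma col_sum_delta v : v = \sum_i v i 0 *: delta_mx i 0.
Proof.
rewrite {1}[v]matrix_sum_delta; apply: eq_bigr => i _.
by rewrite big_ord1.
Qed.

(** The rows orthogonal to [v] that come from the Koszul complex. *)
Definition koszul v (k l : 'I_n) : 'rV[R]_n := v l 0 *: 'e_k - v k 0 *: 'e_l.

Lemma koszul_ker v k l : koszul v k l *m v = 0.
Proof.
by rewrite mulmxBl -!scalemxAl !mul_erow !scale_scalar_mx mulrC subrr.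
Qed.

Lemma koszul_other v k l p : p != k -> p != l -> koszul v k l 0 p = 0.
Proof.
by move=> /negPf pk /negPf pl; rewrite !mxE eqxx pk pl !mulr0 subrr.
Qed.

(** Exactness of the Koszul complex of a unimodular column: the row [L] of Bezout
    coefficients gives the explicit contraction. *)
Lemma koszul_sum f v L : f *m v = 0 -> L *m v = 1%:M ->
  f = \sum_k \sum_l (f 0 k * L 0 l) *: koszul v k l.
Proof.
move=> fv Lv.
have fv' : \sum_k f 0 k * v k 0 = 0.
  by have /matrixP/(_ 0 0) := fv; rewrite !mxE.
have Lv' : \sum_l L 0 l * v l 0 = 1.
  by have /matrixP/(_ 0 0) := Lv; rewrite !mxE.
transitivity ((\sum_l L 0 l * v l 0) *: (\sum_k f 0 k *: 'e_k : 'rV_n) -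
              (\sum_k f 0 k * v k 0) *: (\sum_l L 0 l *: 'e_l : 'rV_n)).
  by rewrite -!row_sum_delta fv' Lv' scale0r subr0 scale1r.
rewrite !scaler_suml.
under [X in _ = X]eq_bigr => k _ do
  under eq_bigr => l _ do rewrite scalerBr !scalerA.
under [X in _ = X]eq_bigr => k _ do rewrite sumrB.
rewrite sumrB; congr (_ - _).
  rewrite exchange_big; apply: eq_bigr => l _ /=; rewrite scaler_sumr.
  by apply: eq_bigr => k _; rewrite scalerA [f 0 k * _]mulrC mulrAC.
apply: eq_bigr => k _ /=; rewrite scaler_sumr.
by apply: eq_bigr => l _; rewrite scalerA mulrAC.
Qed.

End Transvections.

Lemma ord_third n (i j : 'I_n) : (3 <= n)%N -> exists2 p, p != i & p != j.
Proof.
move=> n3; have : (0 < #|~: [set i; j]|)%N.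
  rewrite cardsCs finset.setCK card_ord subn_gt0; apply: leq_trans n3.
  by rewrite cards2; case: eqP.
by case/card_gt0P=> p; rewrite !inE negb_or => /andP[]; exists p.
Qed.

(** * Subgroups containing powers of all elementary matrices *)

Section IntTransvections.
Local Open Scope ring_scope.
Local Open Scope classical_set_scope.
Variables (n : nat) (H : set (SL n int)) (hH : is_subgroup H).
Implicit Types (v w : 'cV[int]_n) (f g : 'rV[int]_n) (x : SL n int).

Lemma sub_tvZ (a : int) v f : f *m v = 0 -> H (tv v f) -> H (tv v (a *: f)).
Proof.
move=> fv Hvf; case: a => k.
  by rewrite -[Posz k]natz -tvX //; apply: subgroupX.
rewrite NegzE scaleNr tvN -?scalemxAl ?fv ?scaler0 //; apply: subgroupV => //.
by rewrite -[Posz _]natz -tvX //; apply: subgroupX.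
Qed.

Section Elementary.
Variable M : int.
Hypothesis Helem : forall i j : 'I_n, i != j -> H (tv (delta_mx i 0) (M *: 'e_j)).

Lemma sub_tv_ecol p f : f 0 p = 0 -> H (tv (delta_mx p 0) (M *: f)).
Proof.
move=> fp; pose Q g := g *m delta_mx p 0 = 0 :> 'M_1 /\ H (tv (delta_mx p 0) (M *: g)).
suff [] : Q f by [].
rewrite [f]row_sum_delta; apply: big_ind => [|g g' [gp Hg] [gp' Hg']|j _].
- by split; rewrite ?mul0mx // scaler0 tv0r; apply: subgroup1.
- split; first by rewrite mulmxDl gp gp' addr0.
  by rewrite scalerDr tvDr -?scalemxAl ?gp ?gp' ?scaler0 //; apply: subgroupM.
have [->|jp] := eqVneq j p.
  rewrite fp scale0r; split; rewrite ?mul0mx // scaler0 tv0r.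
  exact: subgroup1.
have ejp : 'e_j *m delta_mx p 0 = 0 :> 'M[int]_1.
  by apply: erow_ecol; rewrite eq_sym.
split; first by rewrite -scalemxAl ejp scaler0.
rewrite scalerA mulrC -scalerA; apply: sub_tvZ; last by apply: Helem; rewrite eq_sym.
by rewrite -scalemxAl ejp scaler0.
Qed.

Lemma sub_tv_erow p v : v p 0 = 0 -> H (tv (M *: v) 'e_p).
Proof.
move=> vp; pose Q w := 'e_p *m w = 0 :> 'M_1 /\ H (tv (M *: w) 'e_p).
suff [] : Q v by [].
rewrite [v]col_sum_delta; apply: big_ind => [|w w' [wp Hw] [wp' Hw']|j _].
- by split; rewrite ?mulmx0 // scaler0 tv0l; apply: subgroup1.
- split; first by rewrite mulmxDr wp wp' addr0.
  by rewrite scalerDr tvDl -?scalemxAr ?wp ?wp' ?scaler0 //; apply: subgroupM.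
have [->|jp] := eqVneq j p.
  rewrite vp scale0r; split; rewrite ?mulmx0 // scaler0 tv0l.
  exact: subgroup1.
have ejp : 'e_p *m delta_mx j 0 = 0 :> 'M[int]_1 by apply: erow_ecol.
split; first by rewrite -scalemxAr ejp scaler0.
rewrite scalerA mulrC -scalerA tvZ; apply: sub_tvZ.
  by rewrite -scalemxAr ejp scaler0.
by rewrite tvZ; apply: Helem.
Qed.

Lemma tv_split_coord p v f : f *m v = 0 -> f 0 p = 0 ->
  tv v f = (tv (v - v p 0 *: delta_mx p 0) f * tv (delta_mx p 0) (v p 0 *: f))%g.
Proof.
move=> fv fp; have fp' : f *m (v p 0 *: delta_mx p 0) = 0 :> 'M[int]_1.
  by rewrite -scalemxAr mul_ecol fp -scalemx1 scale0r scaler0.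
by rewrite -tvZ -tvDl ?mulmxBr ?fv ?fp' ?subrr // subrK.
Qed.

(** The commutator of [1 + v e_p] and [1 + e_p f] is [1 + v f] when [v] and [f]
    have no [p]-th coordinate: the entry [e_p e_p = 1] glues [v] to [f]. *)
Lemma tv_commutator p v f : f *m v = 0 -> f 0 p = 0 -> v p 0 = 0 ->
  tv v f = (tv v 'e_p * tv (delta_mx p 0) f * (tv v 'e_p)^-1 *
            (tv (delta_mx p 0) f)^-1)%g.
Proof.
move=> fv fp vp.
have fp' : f *m delta_mx p 0 = 0 :> 'M[int]_1 by rewrite mul_ecol fp -scalemx1 scale0r.
have vp' : 'e_p *m v = 0 :> 'M[int]_1 by rewrite mul_erow vp -scalemx1 scale0r.
rewrite tvJtv // fv mul_delta_mx !mxE eqxx scale0r subr0 scale1r addrC.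
by rewrite tvDl // mulgK.
Qed.

(** Splitting off the [p]-th coordinate of [v] leaves a commutator of two elements
    of [H]; each of them absorbs one factor [M], which explains the square. *)
Lemma sub_tv_coord0 p v f : f *m v = 0 -> f 0 p = 0 -> H (tv v ((M * M) *: f)).
Proof.
move=> fv fp.
have Mfp : (M * M *: f) 0 p = 0 by rewrite mxE fp mulr0.
rewrite (@tv_split_coord p) // -?scalemxAl ?fv ?scaler0 //; apply: subgroupM => //.
  set v' := v - _.
  have fv' : f *m v' = 0.
    rewrite mulmxBr fv -scalemxAr mul_ecol fp -scalemx1 scale0r scaler0.
    by rewrite subrr.
  have vp' : v' p 0 = 0 by rewrite !mxE !eqxx mulr1 subrr.
  rewrite -scalerA -tvZ (@tv_commutator p).
  - have H1 := sub_tv_erow vp'; have H2 := sub_tv_ecol fp.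
    by do ![apply: subgroupM => //; try apply: subgroupV => //].
  - by rewrite -scalemxAl -scalemxAr fv' !scaler0.
  - by rewrite mxE fp mulr0.
  - by rewrite mxE vp' mulr0.
rewrite !scalerA mulrCA -scalerA; apply: sub_tv_ecol.
by rewrite mxE fp mulr0.
Qed.

(** A Koszul row involves two coordinates only, so that for [n >= 3] it vanishes at
    some third coordinate. *)
Lemma sub_tv_unimodular v f (L : 'rV_n) : (3 <= n)%N ->
  L *m v = 1%:M -> f *m v = 0 -> H (tv v ((M * M) *: f)).
Proof.
move=> n3 Lv fv.
pose Q g := g *m v = 0 /\ H (tv v ((M * M) *: g)).
suff [] : Q f by [].
have Q0 : Q 0 by split; rewrite ?mul0mx // scaler0 tv0r; apply: subgroup1.
have QD g g' : Q g -> Q g' -> Q (g + g').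
  move=> [gv Hg] [gv' Hg']; split; first by rewrite mulmxDl gv gv' addr0.
  by rewrite scalerDr tvDr -?scalemxAl ?gv ?gv' ?scaler0 //; apply: subgroupM.
rewrite (koszul_sum fv Lv); apply: big_ind => // k _; apply: big_ind => // l _.
have [p pk pl] := ord_third k l n3.
split; first by rewrite -scalemxAl koszul_ker scaler0.
apply: (@sub_tv_coord0 p); first by rewrite -scalemxAl koszul_ker scaler0.
by rewrite mxE koszul_other ?mulr0.
Qed.

(** The conjugate by [g] has direction the [i]-th column of [g], which is unimodular:
    the [i]-th row of the inverse of [g] provides the Bezout coefficients. *)
Lemma normal_core_elem (i j : 'I_n) : (3 <= n)%N -> i != j ->
  normal_core H (tv (delta_mx i 0) ((M * M) *: 'e_j)).
Proof.
move=> n3 ij g; rewrite tvJ; last by rewrite -scalemxAl erow_ecol ?scaler0.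
rewrite -scalemxAl; apply: (@sub_tv_unimodular _ _ ('e_i *m slmx g^-1%g)) => //.
  rewrite -mulmxA (mulmxA (slmx _)) slmx_mulVl mul1mx mul_delta_mx.
  by apply/matrixP=> a b; rewrite !ord1 !mxE.
by rewrite -mulmxA (mulmxA (slmx _)) slmx_mulVl mul1mx erow_ecol.
Qed.

End Elementary.
End IntTransvections.

(** * Normal subgroups containing powers of all elementary matrices *)

Section NormalSubgroups.
Local Open Scope ring_scope.
Local Open Scope classical_set_scope.
Variables (n : nat) (N : set (SL n int)) (hN : is_subgroup N).
Hypothesis nN : normal_set N.
Variable m : int.
Hypotheses (n3 : (3 <= n)%N) (m_neq0 : m != 0).
Hypothesis Nelem :
  forall i j : 'I_n, i != j -> N (tv (delta_mx i 0) (m *: 'e_j)).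

(** As the elementary matrices generate, this makes the principal congruence
    subgroup of level [m] central modulo [N].  The conjugate is [1 + v f] with [v] and [f] congruent to [e_i] and
    [e_j]; up to [N], [f] can be replaced by a Koszul row [f0] of [v] supported on
    the coordinates [i] and [j], then the third coordinate [p] of [v] can be
    removed, and the result is a commutator of two transvections congruent to
    those whose commutator is [1 + e_i e_j]. *)
Lemma eqmod_congruent_conj (i j : 'I_n) (h : SL n int) (B : 'M_n) : i != j ->
    slmx h = 1%:M + m *: B ->
  eqmod N (h * tv (delta_mx i 0) 'e_j * h^-1)%g (tv (delta_mx i 0) 'e_j).
Proof.
move=> ij hB; have ji : j != i by rewrite eq_sym.
have [p pi pj] := ord_third i j n3.
have ip : i != p by rewrite eq_sym. have jp : j != p by rewrite eq_sym.
rewrite tvJ ?erow_ecol //; set v := slmx h *m _; set f := 'e_j *m _.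
pose b : 'cV[int]_n := B *m delta_mx i 0.
have vE : v = delta_mx i 0 + m *: b by rewrite /v hB mulmxDl mul1mx -scalemxAl.
have fE : f = 'e_j - m *: ('e_j *m B *m slmx (h^-1)%g).
  have : (1%:M + m *: B) *m slmx (h^-1)%g = 1%:M by rewrite -hB slmx_mulV.
  rewrite mulmxDl mul1mx => /(canRL (addrK _)) hVE; rewrite /f {1}hVE.
  by rewrite mulmxBr mulmx1 -scalemxAl -scalemxAr mulmxA.
have viE : v i 0 = 1 + m * b i 0 by rewrite vE !mxE !eqxx.
have vjE : v j 0 = m * b j 0 by rewrite vE !mxE (negPf ji) add0r.
have vpE : v p 0 = m * b p 0 by rewrite vE !mxE (negPf pi) add0r.
have fv : f *m v = 0.
  by rewrite /f /v -mulmxA (mulmxA (slmx _)) slmx_mulVl mul1mx erow_ecol.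
pose f0 := koszul v j i; have f0v : f0 *m v = 0 by apply: koszul_ker.
have f0p : f0 0 p = 0 by apply: koszul_other.
pose s := b i 0 *: 'e_j - b j 0 *: 'e_i : 'rV[int]_n.
have f0E : f0 = 'e_j + m *: s.
  rewrite /f0 /koszul viE vjE /s scalerDl scale1r scalerBr !scalerA.
  by rewrite addrA.
pose t : 'rV[int]_n := - ('e_j *m B *m slmx (h^-1)%g) - s.
have ftE : f = f0 + m *: t.
  by rewrite fE f0E /t -addrA -scalerDr [s + _]addrC subrK scalerN.
have tv0 : t *m v = 0.
  have : m *: (t *m v) = 0.
    by move: fv; rewrite ftE mulmxDl f0v add0r -scalemxAl.
  by move/eqP; rewrite scalemx_eq0 (negPf m_neq0) => /eqP.
(* The correction term [1 + m v t] is conjugate by h to a transvection in the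
   direction e_i, hence lies in N. *)
have step1 : eqmod N (tv v f) (tv v f0).
  rewrite ftE tvDr // -?scalemxAl ?tv0 ?scaler0 //; apply: eqmod_mulr => //.
  have th : (t *m slmx h) 0 i = 0.
    by move: tv0; rewrite /v mulmxA mul_ecol => /matrixP/(_ 0 0); rewrite !mxE.
  have := nN h (sub_tv_ecol hN Nelem th); rewrite tvJ.
    by rewrite -/v -scalemxAl -mulmxA slmx_mulV mulmx1.
  by rewrite -scalemxAl mul_ecol th -scalemx1 scale0r scaler0.
apply: eqmod_trans step1 _ => //.
pose v' := v - v p 0 *: delta_mx p 0.
have step2 : eqmod N (tv v f0) (tv v' f0).
  rewrite (@tv_split_coord _ p) //; apply: eqmod_mulr => //.
  rewrite vpE -scalerA; apply: sub_tv_ecol => //.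
  by rewrite mxE f0p mulr0.
apply: eqmod_trans step2 _ => //.
have v'p : v' p 0 = 0 by rewrite !mxE !eqxx mulr1 subrr.
have f0v' : f0 *m v' = 0.
  rewrite mulmxBr f0v -scalemxAr mul_ecol f0p -scalemx1 scale0r scaler0.
  by rewrite subrr.
have eip : (delta_mx i 0 : 'cV[int]_n) p 0 = 0 by rewrite mxE (negPf pi).
have ejp : ('e_j : 'rV[int]_n) 0 p = 0 by rewrite mxE (negPf pj) andbF.
rewrite (@tv_commutator _ p v') //.
rewrite [X in eqmod _ _ X](@tv_commutator _ p) //; last first.
  exact: erow_ecol.
pose w := b - b p 0 *: delta_mx p 0.
have wp : w p 0 = 0 by rewrite !mxE !eqxx mulr1 subrr.
have left : eqmod N (tv v' 'e_p) (tv (delta_mx i 0) 'e_p).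
  have -> : v' = delta_mx i 0 + m *: w.
    by rewrite /v' vpE {1}vE -addrA -scalerA -scalerBr.
  rewrite tvDl; first by apply: eqmod_mulr => //; apply: sub_tv_erow.
    exact: erow_ecol.
  by rewrite -scalemxAr mul_erow wp -scalemx1 scale0r scaler0.
have right : eqmod N (tv (delta_mx p 0) f0) (tv (delta_mx p 0) 'e_j).
  have sp : s 0 p = 0 by rewrite !mxE (negPf pi) (negPf pj) !andbF !mulr0 subrr.
  rewrite f0E tvDr; first by apply: eqmod_mulr => //; apply: sub_tv_ecol.
    exact: erow_ecol.
  by rewrite -scalemxAl mul_ecol sp -scalemx1 scale0r scaler0.
by do ![apply: eqmodM => //; try apply: eqmodV => //].
Qed.

End NormalSubgroups.

Section FiniteIndex.
Local Open Scope ring_scope.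
Local Open Scope classical_set_scope.
Variables (n : nat) (N : set (SL n int)) (hN : is_subgroup N).
Hypothesis nN : normal_set N.
Variable m : nat.
Hypotheses (n3 : (3 <= n)%N) (m_gt0 : (0 < m)%N).
Hypothesis Nelem :
  forall i j : 'I_n, i != j -> N (tv (delta_mx i 0) (m%:Z *: 'e_j)).
Hypothesis elem_gen : forall H : set (SL n int), is_subgroup H ->
  (forall i j : 'I_n, i != j -> H (tv (delta_mx i 0) 'e_j)) -> forall g, H g.

Let residue (z : int) : 'I_m.-1.+1 := inord `|(z %% m%:Z)%Z|%N.

Let residueP y z : residue y = residue z -> (m%:Z %| y - z)%Z.
Proof.
have mZ : m%:Z != 0 by rewrite eqz_nat -lt0n.
have lt_m x : (`|(x %% m%:Z)%Z| < m.-1.+1)%N.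
  by rewrite prednK // -ltz_nat gez0_abs ?modz_ge0 // ltz_mod.
move=> /(congr1 val); rewrite /= !inordK // => eq_yz.
rewrite -eqz_mod_dvd; apply/eqP.
by rewrite -[LHS]gez0_abs ?modz_ge0 // -[RHS]gez0_abs ?modz_ge0 // eq_yz.
Qed.

(** Dietzmann's lemma for the conjugates of the elementary matrices, sorted by
    their position and by the residue modulo [m] of the conjugating matrix. *)
Theorem finite_index_of_elem_powers : finite_index setT N.
Proof.
pose J := {p : 'I_n * 'I_n | p.1 != p.2}.
pose x (p : J) : SL n int := tv (delta_mx (val p).1 0) 'e_((val p).2).
pose X (i : J * SL n int) := (i.2 * x i.1 * i.2^-1)%g.
pose lab (i : J * SL n int) := (i.1, map_mx residue (slmx i.2)).
apply: (@dietzmann _ N _ _ X (fun g i => (i.1, (g * i.2)%g)) lab m) => //.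
- by move=> g [p h]; rewrite /X /= invgM !mulgA.
- move=> [p g] [q h] [<- /matrixP eq_gh]; rewrite /X /=.
  pose C := \matrix_(a, b) ((slmx g a b - slmx h a b) %/ m%:Z)%Z.
  have gE : slmx g = slmx h + m%:Z *: C.
    apply/matrixP=> a b; rewrite !mxE mulrC divzK ?subrKC //.
    by apply: residueP; have := eq_gh a b; rewrite !mxE.
  have kE : slmx (h^-1 * g)%g = 1%:M + m%:Z *: (slmx (h^-1)%g *m C).
    by rewrite slmxM gE mulmxDr slmx_mulVl -scalemxAr.
  have mZ : m%:Z != 0 by rewrite eqz_nat -lt0n.
  have := eqmod_congruent_conj hN nN n3 mZ Nelem (valP p) kE.
  by move/(eqmodJ hN nN h); rewrite invgM invgK !mulgA mulgV mul1g mulgK.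
- move=> [p g]; rewrite /X /= -conjg_exp; apply: nN.
  by rewrite tvX ?natz; [apply: Nelem (valP p)|apply/erow_ecol/(valP p)].
- move=> H hH HX; apply: elem_gen => // i j ij.
  by have := HX (exist _ (i, j) ij, 1%g); rewrite /X /= invg1 mulg1 mul1g.
Qed.

End FiniteIndex.

(** * Generation of SL_n(Z) by elementary matrices *)

Section Euclid.
Local Open Scope ring_scope.
Local Open Scope classical_set_scope.
Variables (n : nat) (H : set (SL n int)) (hH : is_subgroup H).
Hypothesis Helem : forall i j : 'I_n, i != j -> H (tv (delta_mx i 0) 'e_j).

Definition std_cols k (g : SL n int) :=
  forall a b : 'I_n, (b < k)%N -> slmx g a b = (a == b)%:R.

Definition add_row (i j : 'I_n) (c : int) (g : SL n int) : SL n int :=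
  (tv (delta_mx i 0) (c *: 'e_j) * g)%g.

Lemma add_rowE i j c g a b : i != j ->
  slmx (add_row i j c g) a b = slmx g a b + (a == i)%:R * (c * slmx g j b).
Proof.
move=> ij; rewrite /add_row slmxM slmx_tv; last first.
  by rewrite -scalemxAl erow_ecol ?scaler0.
rewrite mulmxDl mul1mx mxE; congr (_ + _).
rewrite -mulmxA -scalemxAl -rowE mxE big_ord1 !mxE eqxx andbT.
by [].
Qed.

Lemma add_row_std k (i j : 'I_n) c g : i != j -> (k <= j)%N ->
  std_cols k g -> std_cols k (add_row i j c g).
Proof.
move=> ij kj gk a b bk; rewrite add_rowE // !gk //.
have /negPf -> : j != b by rewrite -val_eqE /= neq_ltn (leq_trans bk kj) orbT.
by rewrite !mulr0 addr0.
Qed.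

Lemma H_add_row (i j : 'I_n) c g : i != j -> H (add_row i j c g) -> H g.
Proof.
move=> ij; apply: subgroup_mull => //; apply: sub_tvZ => //; last exact: Helem.
exact: erow_ecol.
Qed.

Section Step.
Variable k : 'I_n.
Hypothesis IHk : forall g, std_cols k.+1 g -> H g.

Lemma clear_column g : std_cols k g -> slmx g k k = 1 -> H g.
Proof.
move=> gk gkk; pose w := delta_mx k 0 - col k (slmx g).
have wk : w k 0 = 0 by rewrite !mxE !eqxx gkk subrr.
have ekw : 'e_k *m w = 0 :> 'M[int]_1.
  by rewrite mul_erow wk -scalemx1 scale0r.
have Hw : H (tv w 'e_k).
  rewrite -[w]scale1r; apply: sub_tv_erow => // i j ij; rewrite scale1r.
  exact: Helem.
apply: (subgroup_mull hH Hw); apply: IHk => a b.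
rewrite ltnS leq_eqVlt => hb; rewrite slmxM slmx_tv // mulmxDl mul1mx mxE.
rewrite -mulmxA -rowE [X in _ + X]mxE big_ord1 [X in _ + _ * X]mxE.
case/orP: hb => [/eqP/val_inj ->|bk].
  by rewrite gkk mulr1 !mxE eqxx andbT subrKC.
rewrite !gk //; have /negPf -> : k != b by rewrite -val_eqE /= neq_ltn bk orbT.
by rewrite mulr0 addr0.
Qed.

Definition weight g := (\sum_(a < n | (k <= a)%N) `|slmx g a k|)%N.

(** The entries of the column [k] from the diagonal downwards are coprime: the
    inverse of [g] also has its first [k] columns equal to those of the identity,
    so that its [k]-th row is supported on the columns from [k] on. *)
Lemma unit_column g : std_cols k g ->
  \sum_(a < n | (k <= a)%N) slmx (g^-1)%g k a * slmx g a k = 1.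
Proof.
move=> gk; have /matrixP/(_ k k) := slmx_mulVl g; rewrite !mxE eqxx => sum1.
apply: etrans sum1; rewrite [RHS](bigID (fun a : 'I_n => (k <= a)%N)) /=.
rewrite [X in _ + X]big1 ?addr0 //.
move=> b; rewrite -ltnNge => bk; suff -> : slmx (g^-1)%g k b = 0 by rewrite mul0r.
have /matrixP/(_ k b) := slmx_mulVl g; rewrite !mxE.
rewrite (bigD1 b) //= gk // eqxx mulr1 big1 ?addr0 => [->|a ab].
  by have /negPf -> : k != b by rewrite -val_eqE /= neq_ltn bk orbT.
by rewrite gk // (negPf ab) mulr0.
Qed.

(** Euclid's algorithm on the entries of the column [k] on or below the diagonal,
    by induction on the sum of their absolute values. *)
Lemma euclid_step g : std_cols k g -> H g.
Proof.
have [w] := ubnP (weight g); elim: w g => // w IHw g; rewrite ltnS => le_w gk.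
have reduce (a b : 'I_n) : a != b -> (k <= a)%N -> (k <= b)%N -> slmx g a k != 0 ->
    (`|slmx g a k| <= `|slmx g b k|)%N -> H g.
  move=> ab ka kb ga0 le_ab; pose c := - (slmx g b k %/ slmx g a k)%Z.
  have ba : b != a by rewrite eq_sym.
  apply: (@H_add_row b a c) => //; apply: IHw; last exact: add_row_std.
  apply: leq_trans le_w; rewrite /weight (bigD1 b) //= [ltnRHS](bigD1 b) //=.
  rewrite -addSn leq_add //.
    have -> : slmx (add_row b a c g) b k = (slmx g b k %% slmx g a k)%Z.
      rewrite add_rowE // eqxx mul1r /c mulNr {1}(divz_eq (slmx g b k) (slmx g a k)).
      by rewrite addrAC subrr add0r.
    apply: leq_trans le_ab; have := ltz_mod (slmx g b k) ga0.
    have := modz_ge0 (slmx g b k) ga0; lia.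
  apply: leq_sum => i /andP[_ /negPf ib].
  by rewrite add_rowE // ib mul0r addr0.
have [a ka ga0] : exists2 a : 'I_n, (k <= a)%N & slmx g a k != 0.
  apply: contrapT => none; have := unit_column gk; rewrite big1 // => a ka.
  have [->|ga0] := eqVneq (slmx g a k) 0; first by rewrite mulr0.
  by case: none; exists a.
have [[b [ba kb gb0]]|single] :=
    pselect (exists b : 'I_n, [/\ b != a, (k <= b)%N & slmx g b k != 0]).
  have ab : a != b by rewrite eq_sym.
  by case: (leqP `|slmx g a k| `|slmx g b k|) => [|/ltnW]; apply: reduce.
have g0 b : b != a -> (k <= b)%N -> slmx g b k = 0.
  by move=> ba kb; apply/eqP/negPn/negP => gb0; apply: single; exists b.
have gaV : slmx (g^-1)%g k a * slmx g a k = 1.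
  rewrite -(unit_column gk) (bigD1 a) //= big1 ?addr0 // => b /andP[kb ba].
  by rewrite g0 // mulr0.
(* A single entry is left, and it is a unit: bring it to the diagonal as 1. *)
have ga_pm1 : slmx g a k = 1 \/ slmx g a k = -1.
  by have /orP[/eqP|/eqP] := intUnitRing.unitzPl gaV; [left|right].
have ga_sqr : slmx g a k * slmx g a k = 1 by case: ga_pm1 => ->.
have [eak|ak] := eqVneq a k; last first.
  have k_a : k != a by rewrite eq_sym.
  apply: (@H_add_row k a (slmx g a k)) => //; apply: clear_column.
    exact: add_row_std.
  by rewrite add_rowE // eqxx mul1r ga_sqr g0 // add0r.
subst a; have [gkk|gkk] := eqVneq (slmx g k k) 1; first exact: clear_column.
have {}gkk : slmx g k k = -1 by case: ga_pm1 gkk => // ->; rewrite eqxx.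
have [lt_kn|] := ltnP k.+1 n.
  (* A diagonal entry -1 becomes 1 with the help of the next row. *)
  pose j := Ordinal lt_kn; have kj : k != j by rewrite -val_eqE /= neq_ltn ltnSn.
  have jk : j != k by rewrite eq_sym.
  apply: (@H_add_row j k (-1)) => //; apply: (@H_add_row k j 2) => //.
  apply: clear_column; first by do 2?apply: add_row_std => //=.
  by rewrite !add_rowE // !eqxx (negPf kj) (g0 j) // gkk.
(* In the last column the matrix is triangular, and det g = 1 excludes -1. *)
move=> le_nk; have := eqP (slmx_det g); rewrite -det_tr det_trig; last first.
  apply/is_trig_mxP => i j ij; rewrite mxE gk; last first.
    by apply: leq_trans ij _; rewrite -ltnS (leq_trans _ le_nk).
  by have /negPf -> : j != i by rewrite -val_eqE /= neq_ltn ij orbT.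
rewrite (bigD1 k) //= mxE gkk big1 ?mulr1 // => i ik; rewrite mxE gk ?eqxx //.
by rewrite ltn_neqAle ik -ltnS (leq_trans _ le_nk).
Qed.

End Step.

Theorem elementary_generation g : H g.
Proof.
suff all_k k : (k <= n)%N -> forall g, std_cols (n - k) g -> H g.
  by apply: (all_k n) => // a b; rewrite subnn.
elim: k => [|k IHk] kn {}g.
  rewrite subn0 => gn; suff -> : g = 1%g by apply: subgroup1.
  by apply: val_inj; apply/matrixP => a b; rewrite /= gn // !mxE.
have lt_k : (n - k.+1 < n)%N by rewrite ltn_subrL (leq_trans _ kn).
apply: (@euclid_step (Ordinal lt_k)) => h /=; rewrite subnSK //.
by apply: IHk; apply: ltnW.
Qed.

End Euclid.

(** * From boomerangs to transvections *)

Section Recurrent.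
Local Open Scope ring_scope.
Local Open Scope classical_set_scope.

Definition power_recurrent (G : groupType) (D : set G) :=
  forall x t, D x -> exists2 k, (0 < k)%N & D (t ^+ k * x * (t ^+ k)^-1)%g.

(** The boomerang condition is used for the inverse of [t ^+ r] and a singleton
    only: [x] then lies in a conjugate of [Delta] by a power of this inverse. *)
Lemma boomerang_power_recurrent (G : groupType) (Gamma Delta : set G) :
    is_subgroup Gamma -> finite_index setT Gamma -> boomerang Gamma Delta ->
  power_recurrent Delta.
Proof.
move=> hG fG [[hD sDG] boom] x t Dx.
have [r r_gt0 Gtr] := finite_index_power t hG fG.
have Ggi := subgroupV hG Gtr.
have xG : [set x] `<=` Gamma by move=> _ ->; apply: sDG.
have [k [k_gt0 eqk]] : [set k | (1 <= k)%N /\ Delta `&` [set x] =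
    conj_set ((t ^+ r)^-1 ^+ k)%g Delta `&` [set x]] !=set0.
  apply/set0P/negP => /eqP S0; apply: (boom _ _ Ggi (finite_set1 x) xG).
  by rewrite S0.
have : (Delta `&` [set x]) x by [].
rewrite eqk => -[[h Dh hx] _]; exists (r * k)%N; first by rewrite muln_gt0 r_gt0.
have <- : h = (t ^+ (r * k) * x * (t ^+ (r * k))^-1)%g; last by [].
by rewrite -hx expgnA expVgn invgK !mulgA mulgV mul1g mulgK.
Qed.

Section Vectors.
Variable n : nat.
Implicit Types (v w u : 'cV[int]_n) (f g : 'rV[int]_n).

Lemma col_neq0 v : v != 0 -> exists k, v k 0 != 0.
Proof.
move=> v0; apply: contrapT => none; case/negP: v0; apply/eqP/matrixP => k j.
rewrite !ord1 [RHS]mxE; apply/eqP/negPn/negP => vk; apply: none.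
by exists k.
Qed.

(** If [w] is not proportional to [v], then some row of the Koszul complex of [w],
    that is, some 2 x 2 minor of [v] and [w], is nonzero on [v]. *)
Lemma separate_or_parallel v w : v != 0 ->
  (exists2 f : 'rV_n, f *m w = 0 & (f *m v) 0 0 != 0) \/
  (exists2 k, v k 0 != 0 & v k 0 *: w = w k 0 *: v).
Proof.
move=> /col_neq0[k vk].
have [[l vwl]|par] := pselect (exists l, w l 0 * v k 0 - w k 0 * v l 0 != 0).
  left; exists (koszul w k l); first exact: koszul_ker.
  by rewrite mulmxBl -!scalemxAl !mul_erow !mxE eqxx !mulr1n.
right; exists k => //; apply/matrixP=> l j; rewrite !ord1 !mxE mulrC.
by apply/eqP/negPn/negP; rewrite -subr_eq0 => h; apply: par; exists l.
Qed.

Lemma separate_or_parallel_row f g : f != 0 ->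
  (exists2 v : 'cV_n, g *m v = 0 & (f *m v) 0 0 != 0) \/
  (exists2 k, f 0 k != 0 & f 0 k *: g = g 0 k *: f).
Proof.
move=> f0; have fT0 : f^T != 0 by rewrite trmx_eq0.
case: (separate_or_parallel g^T fT0) => [[h hg hf]|[k fk par]].
  left; exists h^T; first by apply: trmx_inj; rewrite trmx_mul trmxK hg trmx0.
  by rewrite -[f]trmxK -trmx_mul mxE.
right; exists k; first by rewrite mxE in fk.
by apply: trmx_inj; rewrite !linearZ /=; move: par; rewrite !mxE.
Qed.

(** Two rows have a common nonzero kernel vector when [n >= 3]; taking the second
    row to be [e_j], it can be written down from two other coordinates. *)
Lemma common_kernel f (j : 'I_n) : (3 <= n)%N ->
  exists v : 'cV_n, [/\ v != 0, f *m v = 0 & v j 0 = 0].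
Proof.
move=> n3; have [k kj _] := ord_third j j n3; have [l lk lj] := ord_third k j n3.
have ec_neq0 (i : 'I_n) : delta_mx i 0 != 0 :> 'cV[int]_n.
  by apply/eqP=> /matrixP/(_ i 0); rewrite !mxE !eqxx.
have [fk|fk] := eqVneq (f 0 k) 0.
  exists (delta_mx k 0); split=> //; last by rewrite mxE eq_sym (negPf kj).
  by rewrite mul_ecol fk -scalemx1 scale0r.
exists (f 0 l *: delta_mx k 0 - f 0 k *: delta_mx l 0); split.
- apply/eqP=> /matrixP/(_ l 0); rewrite !mxE !eqxx (negPf lk) mulr0 mulr1 add0r.
  by move/eqP; rewrite oppr_eq0 (negPf fk).
- by rewrite mulmxBr -!scalemxAr !mul_ecol !scale_scalar_mx mulrC subrr.
by rewrite !mxE ![j == _]eq_sym (negPf kj) (negPf lj) !mulr0 subrr.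
Qed.

End Vectors.

Section Boomerang.
Variables (n : nat) (D : set (SL n int)) (hD : is_subgroup D).
Hypotheses (n3 : (3 <= n)%N) (recD : power_recurrent D).
Implicit Types (v w u : 'cV[int]_n) (f g : 'rV[int]_n).

(** For [f v = 0], a nontrivial power of [1 + v f] lies in [D].  The exponent may be
    negative, because it absorbs proportionality factors between vectors. *)
Definition has_power v f := exists2 a : int, a != 0 & D (tv v (a *: f)).

Lemma natz_neq0 k : (0 < k)%N -> k%:R != 0 :> int.
Proof. by rewrite pnatr_eq0 lt0n. Qed.

(** Conjugating [1 + v f] by a power of [1 + w g], with [g w = 0] and [g v != 0],
    adds a nonzero multiple of [w] to [v]; it leaves [f] alone because [f w = 0]. *)
Lemma has_power_col v w f : v != 0 -> f *m v = 0 -> f *m w = 0 ->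
  has_power v f -> has_power w f.
Proof.
move=> v0 fv fw [a a0 Da].
have afv : (a *: f) *m v = 0 by rewrite -scalemxAl fv scaler0.
have afw : (a *: f) *m w = 0 by rewrite -scalemxAl fw scaler0.
case: (separate_or_parallel w v0) => [[g gw gv]|[k vk par]].
  have [k k_gt0] := recD (tv w g) Da.
  have kgw : (k%:R *: g) *m w = 0 by rewrite -scalemxAl gw scaler0.
  rewrite tvX // tvJtv // afw [X in _ - X *: _]mxE scale0r subr0.
  set c := (_ *m v) 0 0; have c0 : c != 0.
    by rewrite /c -scalemxAl mxE mulf_neq0 ?natz_neq0.
  rewrite tvDl // -?scalemxAr ?afw ?scaler0 // => /(subgroup_mull hD Da).
  by rewrite tvZ scalerA => Dw; exists (c * a) => //; apply: mulf_neq0.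
exists (v k 0 * a); first exact: mulf_neq0.
by rewrite -scalerA -tvZ par tvZ; apply: sub_tvZ.
Qed.

(** The dual of [has_power_col]: conjugating by a power of [1 + u g], with [g u = 0]
    and [f u != 0], adds a nonzero multiple of [g] to [f]; it leaves [v] alone
    because [g v = 0]. *)
Lemma has_power_row v f g : f != 0 -> f *m v = 0 -> g *m v = 0 ->
  has_power v f -> has_power v g.
Proof.
move=> f0 fv gv [a a0 Da].
have afv : (a *: f) *m v = 0 by rewrite -scalemxAl fv scaler0.
case: (separate_or_parallel_row g f0) => [[u gu fu]|[k fk par]].
  have [k k_gt0] := recD (tv u g) Da.
  have kgu : (k%:R *: g) *m u = 0 by rewrite -scalemxAl gu scaler0.
  have kgv : (k%:R *: g) *m v = 0 by rewrite -scalemxAl gv scaler0.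
  rewrite tvX // tvJtv // kgv [X in _ + X *: _]mxE scale0r addr0.
  rewrite scalerA -scaleNr; set c := - _; have c0 : c != 0.
    by rewrite oppr_eq0 -scalemxAl mxE !mulf_neq0 ?natz_neq0.
  rewrite tvDr // -?scalemxAl ?gv ?scaler0 // => /(subgroup_mull hD Da) Dg.
  by exists c.
exists (f 0 k * a); first exact: mulf_neq0.
rewrite mulrC -scalerA par scalerA mulrC -scalerA.
by apply: sub_tvZ.
Qed.

(** The path is [(v, f)], [(u, f)], [(u, e_j)], [(e_i, e_j)], where [u] is killed by
    both [f] and [e_j]. *)
Lemma has_power_elem v f (i j : 'I_n) : v != 0 -> f != 0 -> f *m v = 0 ->
  D (tv v f) -> i != j -> has_power (delta_mx i 0) 'e_j.
Proof.
move=> v0 f0 fv Dvf ij.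
have [u [u0 fu uj]] := common_kernel f j n3.
have ju : 'e_j *m u = 0 :> 'M[int]_1 by rewrite mul_erow uj -scalemx1 scale0r.
apply: (has_power_col u0) => //; first exact: erow_ecol.
apply: (has_power_row f0) => //; apply: (has_power_col v0) => //.
by exists 1; rewrite ?scale1r.
Qed.

Lemma common_elem_power v f : v != 0 -> f != 0 -> f *m v = 0 -> D (tv v f) ->
  exists2 m : nat, (0 < m)%N &
    forall i j : 'I_n, i != j -> D (tv (delta_mx i 0) (m%:Z *: 'e_j)).
Proof.
move=> v0 f0 fv Dvf.
have /choice[a aP] (p : 'I_n * 'I_n) : exists a : int, a != 0 /\
    (p.1 != p.2 -> D (tv (delta_mx p.1 0) (a *: 'e_(p.2)))).
  have [eqp|neqp] := eqVneq p.1 p.2; first by exists 1.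
  by have [a a0 Da] := has_power_elem v0 f0 fv Dvf neqp; exists a.
pose m := \prod_p a p.
have Dm (i j : 'I_n) : i != j -> D (tv (delta_mx i 0) (m *: 'e_j)).
  move=> ij; have [_ /(_ ij) Dij] := aP (i, j).
  rewrite /m (bigD1 (i, j)) //= mulrC -scalerA; apply: sub_tvZ => //.
  by rewrite -scalemxAl erow_ecol ?scaler0.
exists `|m|%N.
  by rewrite absz_gt0; apply/prodf_neq0 => p _; case: (aP p).
move=> i j ij; rewrite abszEsg -scalerA; apply: sub_tvZ => //; last exact: Dm.
by rewrite -scalemxAl erow_ecol ?scaler0.
Qed.

(** The centralizer of the matrices [E_ij] consists of the scalar matrices, and
    the only units of Z are 1 and -1. *)
Lemma central_of_commute (x : SL n int) :
    (forall i j, i != j ->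
       slmx x *m delta_mx i j = delta_mx i j *m slmx x :> 'M_n) ->
  slmx x = 1%:M \/ slmx x = - 1%:M.
Proof.
move=> comm.
have entryL i j a b : (slmx x *m delta_mx i j) a b = slmx x a i * (b == j)%:R.
  rewrite mxE (bigD1 i) //= big1 ?addr0 => [|l li]; first by rewrite mxE eqxx.
  by rewrite mxE (negPf li) mulr0.
have entryR i j a b : (delta_mx i j *m slmx x) a b = (a == i)%:R * slmx x j b.
  rewrite mxE (bigD1 j) //= big1 ?addr0 => [|l lj]; first by rewrite mxE eqxx andbT.
  by rewrite mxE (negPf lj) andbF mul0r.
have entry i j a b : i != j ->
    slmx x a i * (b == j)%:R = (a == i)%:R * slmx x j b.
  by move=> ij; rewrite -entryL comm // entryR.
have n0 : (0 < n)%N by apply: leq_trans n3.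
pose c := slmx x (Ordinal n0) (Ordinal n0).
have xc : slmx x = c%:M.
  apply/matrixP=> a b; rewrite mxE; have [->|ab] := eqVneq a b.
    have [->//|b0] := eqVneq b (Ordinal n0).
    by have := entry _ _ b (Ordinal n0) b0; rewrite !eqxx mulr1 mul1r.
  have ba : b != a by rewrite eq_sym.
  by have := entry b a a a ba; rewrite eqxx (negPf ab) mulr1 mul0r.
have := eqP (slmx_det x); rewrite xc det_scalar => cn.
have : c \is a GRing.unit by rewrite -(unitrX_pos c n0) cn unitr1.
case/orP=> /eqP ->; first by left.
by right; rewrite raddfN.
Qed.

Definition nontrivial_transvection :=
  exists v f, [/\ v != 0, f != 0, f *m v = 0 & D (tv v f)].

(** For a row [f] with [f u = 0], the commutator of a power of [1 + u f] with [g] is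
    [1 + k u (f - f g^-1)], which is as wanted unless [f g = f].  If this fails for
    all such [f], then [P = g - 1] has rank one with image in the line of [u], and
    [P^2 = 0]; as [u] may be imprimitive, only a power of [g] has the form
    [1 + u f] up to sign. *)
Lemma transvection_of_fixed_vector (g : SL n int) u :
    D g -> g != 1%g -> u != 0 -> slmx g *m u = u ->
  nontrivial_transvection.
Proof.
move=> Dg g1 u0 gu.
have gVu : slmx (g^-1)%g *m u = u by rewrite -{1}gu mulmxA slmx_mulVl mul1mx.
have [[f [fu fg]]|all_fix] := pselect
    (exists f : 'rV_n, f *m u = 0 /\ f *m slmx (g^-1)%g != f).
  have [k k_gt0] := recD (tv u f) Dg.
  rewrite tvX // => Dk.
  have kfu : k%:R *: f *m u = 0 by rewrite -scalemxAl fu scaler0.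
  have Nkfu : - (k%:R *: f) *m u = 0 by rewrite mulNmx kfu oppr0.
  have fgu : f *m slmx (g^-1)%g *m u = 0 by rewrite -mulmxA gVu.
  exists u, (k%:R *: (f - f *m slmx (g^-1)%g)); split=> //.
  - by rewrite scalemx_eq0 (negPf (natz_neq0 k_gt0)) subr_eq0 eq_sym.
  - by rewrite -scalemxAl mulmxBl fu fgu subrr scaler0.
  have := subgroupM hD Dk (subgroupV hD Dg).
  rewrite -!mulgA -tvN // [(g * _)%g]mulgA tvJ // gu mulNmx -tvDr //.
    by rewrite -scalemxAl -scalerBr.
  by rewrite mulNmx -!scalemxAl fgu scaler0 oppr0.
have [k uk] := col_neq0 u0.
pose P := slmx g - 1%:M; pose f := row k P.
have Pu : P *m u = 0 by rewrite mulmxBl gu mul1mx subrr.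
have fP (h : 'rV_n) : h *m u = 0 -> h *m P = 0.
  move=> hu; have hg : h *m slmx (g^-1)%g = h.
    by apply/eqP/negPn/negP => hg; apply: all_fix; exists h.
  by rewrite mulmxBr mulmx1 -{1}hg -mulmxA slmx_mulVl mulmx1 subrr.
have fu : f *m u = 0 by rewrite -row_mul Pu; apply/rowP=> j; rewrite !mxE.
have rank1 : u k 0 *: P = u *m f.
  apply/row_matrixP=> l; rewrite row_mul.
  have := fP _ (koszul_ker u k l); rewrite mulmxBl -!scalemxAl -!rowE.
  move/eqP; rewrite subr_eq0 => /eqP eql.
  rewrite linearZ /= [row l u]mx11_scalar mul_scalar_mx !mxE.
  by rewrite -eql.
have P2 : P *m P = 0.
  have : u k 0 *: (P *m P) = 0 by rewrite scalemxAr rank1 mulmxA Pu mul0mx.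
  by move/eqP; rewrite scalemx_eq0 (negPf uk) => /eqP.
have gX a : slmx (g ^+ a)%g = 1%:M + a%:R *: P.
  elim: a => [|a IHa]; first by rewrite expg0 scale0r addr0.
  rewrite expgS slmxM IHa mulmxDr mulmx1 -scalemxAr -{2}[slmx g](subrK 1%:M).
  rewrite -/P mulmxDl P2 mul1mx add0r -[in LHS](subrK 1%:M (slmx g)) -/P.
  by rewrite [P + _]addrC -addrA mulrS scalerDl scale1r.
pose s := sgz (u k 0); have s0 : s != 0 by rewrite sgz_eq0.
exists (s *: u), f; split=> //.
- by rewrite scalemx_eq0 (negPf s0).
- apply: contra g1 => /eqP f0; move: rank1; rewrite f0 mulmx0 => /eqP.
  by rewrite scalemx_eq0 (negPf uk) subr_eq0 => /eqP gE; apply/eqP/val_inj.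
- by rewrite -scalemxAr fu scaler0.
suff -> : tv (s *: u) f = (g ^+ `|u k 0|)%g by apply: subgroupX.
apply: val_inj; rewrite [RHS]gX [LHS]slmx_tv; last by rewrite -scalemxAr fu scaler0.
by rewrite -scalemxAl -rank1 scalerA natz abszEsg.
Qed.

(** A commutator of an elementary matrix with [x] is a product of two
    transvections, with rows proportional to [e_j] and [e_j x^-1]; it fixes their
    common kernel. *)
Lemma transvection_of_noncentral (x : SL n int) :
    D x -> ~ (slmx x = 1%:M \/ slmx x = - 1%:M) ->
  nontrivial_transvection.
Proof.
move=> Dx xNc.
have [i [j [ij ncomm]]] : exists i j : 'I_n, i != j /\
    slmx x *m delta_mx i j <> delta_mx i j *m slmx x.
  apply: contrapT => comm; apply/xNc/central_of_commute => i j ij.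
  by apply: contrapT => nc; apply: comm; exists i, j.
have eji := erow_ecol int ij.
have [k k_gt0 Dk] := recD (tv (delta_mx i 0) 'e_j) Dx.
move: Dk; rewrite tvX //; set f := k%:R *: _; set t := tv _ f => Dk.
have fi : f *m delta_mx i 0 = 0 :> 'M[int]_1 by rewrite -scalemxAl eji scaler0.
pose g := (t * x * t^-1 * x^-1)%g.
have [u [u0 fxu uj]] := common_kernel ('e_j *m slmx (x^-1)%g) j n3.
have ju : 'e_j *m u = 0 :> 'M[int]_1 by rewrite mul_erow uj -scalemx1 scale0r.
apply: (@transvection_of_fixed_vector g u) => //.
- by apply: subgroupM => //; apply: subgroupV.
- apply/eqP => /(canRL (mulgK _)); rewrite invgK mul1g => /(canRL (mulgK _)).
  rewrite invgK => /(congr1 (@slmx _ _)); rewrite !slmxM slmx_tv //.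
  rewrite mulmxDl mulmxDr mul1mx mulmx1 => /addrI.
  rewrite /f -scalemxAr mul_delta_mx -scalemxAl -scalemxAr.
  by move/(scalemx_inj (natz_neq0 k_gt0)) => /esym.
have -> : g = (t * (x * t^-1 * x^-1))%g by rewrite /g !mulgA.
have fu : f *m u = 0 :> 'M[int]_1 by rewrite -scalemxAl ju scaler0.
have fxu' : - f *m slmx (x^-1)%g *m u = 0 :> 'M[int]_1.
  by rewrite -mulmxA mulNmx -scalemxAl mulmxA fxu scaler0 oppr0.
have Nfi : - f *m delta_mx i 0 = 0 :> 'M[int]_1 by rewrite mulNmx fi oppr0.
have fxi : - f *m slmx (x^-1)%g *m (slmx x *m delta_mx i 0) = 0 :> 'M[int]_1.
  by rewrite -mulmxA (mulmxA (slmx _)) slmx_mulVl mul1mx.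
rewrite slmxM -mulmxA /t -tvN // tvJ // (tv_mulcol _ fxi) fxu' mxE scale0r addr0.
by rewrite tv_mulcol // fu mxE scale0r addr0.
Qed.

Theorem finite_index_of_noncentral (x : SL n int) (Gamma : set (SL n int)) :
    D x -> ~ (slmx x = 1%:M \/ slmx x = - 1%:M) ->
  finite_index Gamma D.
Proof.
move=> Dx xNc.
have [v [f [v0 f0 fv Dvf]]] := transvection_of_noncentral Dx xNc.
have [m m_gt0 Delem] := common_elem_power v0 f0 fv Dvf.
have hN := normal_core_subgroup hD.
apply: (finite_index_super _ hN hD (@normal_core_sub _ D)).
apply: (finite_index_of_elem_powers hN (@normal_core_normal _ D) n3 (m := m * m)).
- by rewrite muln_gt0 m_gt0.
- by move=> i j ij; rewrite PoszM; apply: normal_core_elem.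
by move=> H hH Helem g; apply: elementary_generation.
Qed.

End Boomerang.
End Recurrent.

Local Open Scope ring_scope.
Local Open Scope classical_set_scope.

Theorem corollary1p3 (n : nat) (hn : (3 <= n)%N)
    (Gamma : set (SL n int)) (hGamma : is_subgroup Gamma)
    (hindex : finite_index setT Gamma)
    (Delta : set (SL n int)) (hDelta : boomerang Gamma Delta) :
  Delta `<=` [set A | slmx A = 1%:M \/ slmx A = - 1%:M] \/
  finite_index Gamma Delta.
Proof.
have recD := boomerang_power_recurrent hGamma hindex hDelta.
have [[hD _] _] := hDelta.
have [central|] := pselect (Delta `<=` [set A | slmx A = 1%:M \/ slmx A = - 1%:M]).
  by left.
move=> noncentral; right.
have [x [Dx xNc]] : exists x, Delta x /\ ~ (slmx x = 1%:M \/ slmx x = - 1%:M).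
  apply: contrapT => none; apply: noncentral => x Dx /=.
  by apply: contrapT => xNc; apply: none; exists x.
exact: finite_index_of_noncentral Dx xNc.
Qed.
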